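(* Let $\Gamma$ be the Cartan grading on the Cayley algebra $\mathcal{C}$ over an algebraically closed field $\mathbb{F}$ (of any characteristic). Identify $\mathrm{Supp}\,\Gamma\setminus\{0\}$ with the set of short roots in the root system $\Phi$ of type $G_2$ defined in the context. Then $W(\Gamma)=\mathrm{Aut}\,\Phi$.
   Context: Gradings and Weyl groups. For a grading $\Gamma:\mathcal{A}=\bigoplus_{g\in G}\mathcal{A}_g$ of a (nonassociative) algebra by an abelian group $G$ ($\mathcal{A}_g\mathcal{A}_h\subset\mathcal{A}_{g+h}$, additive notation), $\mathrm{Supp}\,\Gamma=\{g:\mathcal{A}_g\neq0\}$; $\mathrm{Aut}(\Gamma)$ is the group of algebra automorphisms of $\mathcal{A}$ permuting the nonzero components $\mathcal{A}_g$; $\mathrm{Stab}(\Gamma)$ is the subgroup of those leaving each component invariant; the Weyl group is $W(\Gamma)=\mathrm{Aut}(\Gamma)/\mathrm{Stab}(\Gamma)$. When $G$ is the universal abelian group of $\Gamma$ (i.e., for any realization of the same decomposition as a grading by an abelian group $H$ there is a unique homomorphism $G\to H$ restricting to the identity on the support), each $\varphi\in\mathrm{Aut}(\Gamma)$ induces a unique automorphism $u$ of $G$ with $\varphi(\mathcal{A}_s)=\mathcal{A}_{u(s)}$ for all $s\in\mathrm{Supp}\,\Gamma$, and in this way $W(\Gamma)$ is regarded as a subgroup of $\mathrm{Aut}(G)$. Cayley algebra. $\mathcal{C}$ is the $8$-dimensional algebra over $\mathbb{F}$ with basis $\{e_1,e_2,u_1,u_2,u_3,v_1,v_2,v_3\}$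 (a ''good basis'') and multiplication, with indices $i,j$ of $u,v$ in $\{1,2,3\}$ taken modulo $3$: $e_1^2=e_1$, $e_2^2=e_2$, $e_1e_2=e_2e_1=0$; $e_1u_i=u_i=u_ie_2$, $e_2v_i=v_i=v_ie_1$, $e_2u_i=u_ie_1=e_1v_i=v_ie_2=0$; $u_iv_i=-e_1$, $v_iu_i=-e_2$, $u_iv_j=v_iu_j=0$ for $i\ne j$; $u_i^2=v_i^2=0$; $u_iu_{i+1}=-u_{i+1}u_i=v_{i+2}$, $v_iv_{i+1}=-v_{i+1}v_i=u_{i+2}$. Cartan grading. Let $S=\mathbb{R}(1,1,1)\subset\mathbb{R}^3$, $E=\mathbb{R}^3/S$, $\epsilon_1=(1,0,0)+S$, $\epsilon_2=(0,1,0)+S$, $\epsilon_3=(0,0,1)+S$, and $G=\mathbb{Z}\epsilon_1+\mathbb{Z}\epsilon_2+\mathbb{Z}\epsilon_3\cong\mathbb{Z}^2$. The Cartan grading $\Gamma$ is the $G$-grading with $\deg e_1=\deg e_2=0$ and $\deg u_i=\epsilon_i=-\deg v_i$, $i=1,2,3$. Its universal abelian group is $G$, and $\mathrm{Supp}\,\Gamma=\{0\}\cup\{\pm\epsilon_i: i=1,2,3\}$. The group $\mathrm{Aut}(G)$ is identified with a subgroup of $GL(E)$ by linear extension, so $W(\Gamma)$ is regarded as a subgroup of $GL(E)$. Root system. $\Phi=\bigl(\mathrm{Supp}\,\Gamma\cup\{\alpha+\beta:\alpha,\beta\in\mathrm{Supp}\,\Gamma,\ \alpha\neq\pm\beta\}\bigr)\setminus\{0\}$,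 which is a root system of type $G_2$ in $E$, and $\mathrm{Aut}\,\Phi=\{\mu\in GL(E):\mu(\Phi)=\Phi\}$. *)

(* Defs.v *)
From HB Require Import structures.
From mathcomp Require Import all_boot all_order all_algebra.
From mathcomp Require Import boolp classical_sets reals.

Set Implicit Arguments.
Unset Strict Implicit.
Unset Printing Implicit Defensive.

Import GRing.Theory.
Local Open Scope ring_scope.
Local Open Scope classical_set_scope.

Section Gradings.
Variables (F : fieldType) (A : vectType F) (mul : A -> A -> A).

Definition supp (G : zmodType) (Gam : G -> {vspace A}) : set G :=
  [set g | Gam g <> 0%VS].

(* [A] is finite-dimensional, so the support of a grading is finite; [s] lists
   the (finitely many) degrees that occur in the decomposition. *)
Definition is_grading (G : zmodType) (Gam : G -> {vspace A}) : Prop :=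
  (exists s : seq G,
    [/\ uniq s, supp Gam `<=` [set` s],
        directv (\sum_(g <- s) Gam g)%VS
      & (\sum_(g <- s) Gam g)%VS = fullv]) /\
  (forall g h x y, x \in Gam g -> y \in Gam h -> mul x y \in Gam (g + h)).

Definition algebra_aut : set 'End(A) :=
  [set phi | bijective phi /\ forall x y, phi (mul x y) = mul (phi x) (phi y)].

Variables (G : zmodType) (Gam : G -> {vspace A}).

Definition is_universal : Prop :=
  forall (H : zmodType) (Del : H -> {vspace A}),
    is_grading Del -> Gam @` supp Gam = Del @` supp Del ->
    exists! f : G -> H,
      zmod_morphism f /\ forall s, supp Gam s -> Del (f s) = Gam s.

Definition grading_aut : set 'End(A) :=
  [set phi | algebra_aut phi /\
    [set (phi @: Gam s)%VS | s in supp Gam] = Gam @` supp Gam].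

Definition grading_stab : set 'End(A) :=
  [set phi | algebra_aut phi /\
    forall s, supp Gam s -> (phi @: Gam s)%VS = Gam s].

Definition group_aut : set (G -> G) :=
  [set u | zmod_morphism u /\ bijective u].

Definition induces (phi : 'End(A)) (u : G -> G) : Prop :=
  forall s, supp Gam s -> (phi @: Gam s)%VS = Gam (u s).

(* Meant for [G] universal: by [induces_ex1] and [induces_stab] below, this is
   then the image of an embedding of [grading_aut / grading_stab]. *)
Definition weyl_group : set (G -> G) :=
  [set u | group_aut u /\ exists2 phi, grading_aut phi & induces phi u].

End Gradings.

Section GradingTheory.
Variables (F : fieldType) (A : vectType F) (mul : A -> A -> A).

Lemma grading_deg_inj (G : zmodType) (Gam : G -> {vspace A}) g h x :
  is_grading mul Gam -> x != 0 -> x \in Gam g -> x \in Gam h -> g = h.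
Proof.
move=> [[s [us sups dir _]] _] x0 xg xh.
have in_s k : x \in Gam k -> k \in s.
  move=> xk; apply: sups => /= Gk; move: xk.
  by rewrite Gk memv0 (negPf x0).
apply/eqP/negPn/negP => ngh; move: dir; rewrite directvE /= => /eqP dim_sum.
have hs : h \in rem g s by rewrite mem_rem_uniq // inE eq_sym ngh in_s.
have ps : perm_eq s [:: g, h & rem h (rem g s)].
  rewrite (perm_trans (perm_to_rem (in_s _ xg))) // perm_cons.
  exact: perm_to_rem.
move: dim_sum; rewrite !(perm_big _ ps) /= !big_cons addvA addnA => dim_sum.
have := dimv_add_leqif (Gam g + Gam h) (\sum_(j <- rem h (rem g s)) Gam j)%VS.
move=> [+ _]; rewrite dim_sum => le1.
have := leq_trans le1 (leq_add (leqnn _) (leq_trans (dimv_leq_sum _ _ _) (leqnn _))).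
rewrite leq_add2r -(dimv_sum_cap (Gam g)) leqNgt -addn1 leq_add2l.
by rewrite lt0n dimv_eq0; case: eqP => // c0 _; move: x0;
  rewrite -memv0 -c0 memv_cap xg xh.
Qed.

Lemma algebra_aut_inv phi : algebra_aut mul phi -> algebra_aut mul (phi^-1)%VF.
Proof.
move=> [bij mor]; have ker0 : lker phi == 0%VS.
  by apply/lker0P; exact: bij_inj.
have K := lker0_lfunK ker0; have K' := lker0_lfunVK ker0.
split; first by exists phi; [exact: K'|exact: K].
by move=> x y; rewrite -{1}[x]K' -{1}[y]K' -mor K.
Qed.

Lemma algebra_aut_lker phi : algebra_aut mul phi -> lker phi == 0%VS.
Proof. by move=> [bij _]; apply/lker0P; exact: bij_inj. Qed.

Lemma algebra_aut_imgK phi (W : {vspace A}) : algebra_aut mul phi ->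
  (phi^-1 @: (phi @: W))%VS = W.
Proof.
by move=> /algebra_aut_lker k; rewrite -limg_comp lker0_compVf // lim1g.
Qed.

Lemma algebra_aut_imgVK phi (W : {vspace A}) : algebra_aut mul phi ->
  (phi @: (phi^-1 @: W))%VS = W.
Proof.
by move=> /algebra_aut_lker k; rewrite -limg_comp lker0_compfV // lim1g.
Qed.

Lemma algebra_aut_img0 phi (W : {vspace A}) : algebra_aut mul phi ->
  (phi @: W)%VS = 0%VS -> W = 0%VS.
Proof. by move=> ap p0; rewrite -(algebra_aut_imgK W ap) p0 limg0. Qed.

Lemma img_is_grading (G : zmodType) (Gam : G -> {vspace A}) phi :
  algebra_aut mul phi -> is_grading mul Gam ->
  is_grading mul (fun g => (phi @: Gam g)%VS).
Proof.
move=> ap [[s [us sups dir ful]] hmul]; have k := algebra_aut_lker ap.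
split.
  exists s; split=> //.
  - by move=> g /= pg; apply: sups => /= g0; apply: pg; rewrite g0 limg0.
  - rewrite directvE /= -limg_sum ful limg_dim_eq; last by rewrite (eqP k) capv0.
    rewrite -ful; move: dir; rewrite directvE /= => /eqP->.
    by apply/eqP/eq_bigr => g _; rewrite limg_dim_eq // (eqP k) capv0.
  - by rewrite -limg_sum ful lker0_limgf.
move=> g h x y /memv_imgP[x' x'g ->] /memv_imgP[y' y'h ->].
by rewrite -ap.2 memv_img // hmul.
Qed.

Section Weyl.
Variables (G : zmodType) (Gam : G -> {vspace A}).
Hypotheses (gGam : is_grading mul Gam) (uGam : is_universal mul Gam).

Lemma grading_autV phi : grading_aut mul Gam phi -> grading_aut mul Gam (phi^-1)%VF.
Proof.
move=> [ap comp]; split; first exact: algebra_aut_inv.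
apply/seteqP; split=> W [s ss <-].
  have [t ts <-] : [set (phi @: Gam s)%VS | s in supp Gam] (Gam s).
    by rewrite comp; exists s.
  by rewrite algebra_aut_imgK //; exists t.
have [t ts e] : [set Gam s | s in supp Gam] (phi @: Gam s)%VS.
  by rewrite -comp; exists s.
by exists t => //; rewrite e algebra_aut_imgK.
Qed.

Lemma supp_img phi : algebra_aut mul phi ->
  supp (fun g => (phi @: Gam g)%VS) = supp Gam.
Proof.
move=> ap; apply/seteqP; split=> s /= ss; move: (ss) => /= ss0 e; apply: ss0.
  by rewrite e limg0.
exact: algebra_aut_img0 e.
Qed.

Lemma induces_supp phi u s : algebra_aut mul phi -> induces Gam phi u ->
  supp Gam s -> supp Gam (u s).
Proof.
move=> ap ind ss /= us0; apply: (ss); apply: (algebra_aut_img0 ap).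
by rewrite ind.
Qed.

Lemma induces_hom phi : grading_aut mul Gam phi ->
  exists2 u : G -> G, zmod_morphism u & induces Gam phi u.
Proof.
move=> gp; have gV := grading_autV gp; have [apV compV] := gV.
have e : Gam @` supp Gam =
    (fun g => (phi^-1 @: Gam g)%VS) @` supp (fun g => (phi^-1 @: Gam g)%VS).
  by rewrite supp_img.
have [u [[uadd uDel] _]] := uGam (img_is_grading apV gGam) e.
exists u => // s ss.
by rewrite -(uDel s ss) algebra_aut_imgVK //; exact: gp.1.
Qed.

Lemma universal_id (u : G -> G) : zmod_morphism u ->
  (forall s, supp Gam s -> Gam (u s) = Gam s) -> u = id.
Proof.
move=> uadd uG; have [f [_ funi]] := uGam gGam erefl.
rewrite -(funi u) //; apply: funi; split=> //; exact: id.
Qed.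

Lemma induces_ex1 phi : grading_aut mul Gam phi ->
  exists! u : G -> G, group_aut u /\ induces Gam phi u.
Proof.
move=> gp; have gV := grading_autV gp.
have [u uadd uind] := induces_hom gp; have [v vadd vind] := induces_hom gV.
have ap := gp.1; have apV := gV.1.
have vl w : zmod_morphism w -> induces Gam phi w -> v \o w = id.
  move=> wadd wind; apply: universal_id => [x y|s ss] /=.
    by rewrite wadd vadd.
  by rewrite -(vind _ (induces_supp ap wind ss)) -(wind _ ss) algebra_aut_imgK.
have uv : u \o v = id.
  apply: universal_id => [x y|s ss] /=; first by rewrite vadd uadd.
  by rewrite -(uind _ (induces_supp apV vind ss)) -(vind _ ss) algebra_aut_imgVK.
exists u; split.
  split=> //; split=> //; exists v => x.
    exact: (congr1 (@^~ x) (vl _ uadd uind)).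
  exact: (congr1 (@^~ x) uv).
move=> w [[wadd _] wind]; apply/funext => x.
have vwx := congr1 (@^~ x) (vl _ wadd wind); rewrite /= in vwx.
have uvx := congr1 (@^~ (w x)) uv; rewrite /= in uvx.
by rewrite -[RHS]uvx vwx.
Qed.

Lemma induces_stab phi psi u w :
  grading_aut mul Gam phi -> grading_aut mul Gam psi ->
  group_aut u -> group_aut w -> induces Gam phi u -> induces Gam psi w ->
  u = w <-> grading_stab mul Gam (phi^-1 \o psi)%VF.
Proof.
move=> gp gq gu gw iu iw; have ap := gp.1; have aq := gq.1.
have apV := algebra_aut_inv ap.
have comp_aut : algebra_aut mul (phi^-1 \o psi)%VF.
  split; last by move=> x y; rewrite !lfunE /= aq.2 apV.2.
  by apply: (eq_bij (bij_comp apV.1 aq.1)) => x; rewrite lfunE.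
split=> [uw|[_ st]].
  by split=> // s ss; rewrite limg_comp (iw _ ss) -uw -(iu _ ss) algebra_aut_imgK.
have [v [_ vuni]] := induces_ex1 gp.
rewrite -(vuni u) //; apply: vuni; split=> // s ss.
have := st s ss; rewrite limg_comp => /(congr1 (fun W => (phi @: W)%VS)).
by rewrite algebra_aut_imgVK // => <-; exact: iw.
Qed.
End Weyl.
End GradingTheory.

Inductive cayley_basis := E1 | E2 | U of 'I_3 | V of 'I_3.

Definition cayley_basis_code (a : cayley_basis) : bool + ('I_3 + 'I_3) :=
  match a with
  | E1 => inl true | E2 => inl false | U i => inr (inl i) | V i => inr (inr i)
  end.
Definition cayley_basis_decode (c : bool + ('I_3 + 'I_3)) : cayley_basis :=
  match c with
  | inl true => E1 | inl false => E2 | inr (inl i) => U i | inr (inr i) => V i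
  end.
Lemma cayley_basis_codeK : cancel cayley_basis_code cayley_basis_decode.
Proof. by case. Qed.
HB.instance Definition _ := Finite.copy cayley_basis
  (can_type cayley_basis_codeK).

Section Cayley.
Variable F : fieldType.

Definition cayley := {ffun cayley_basis -> F^o}.
HB.instance Definition _ := Vector.on cayley.

Definition cb (a : cayley_basis) : cayley := [ffun b => (a == b)%:R].

(* ['I_3] carries its ring structure of integers modulo 3. *)
Definition cb_mul (a b : cayley_basis) : cayley :=
  match a, b with
  | E1, E1 => cb E1
  | E2, E2 => cb E2
  | E1, U i => cb (U i)
  | U i, E2 => cb (U i)
  | E2, V i => cb (V i)
  | V i, E1 => cb (V i)
  | U i, V j => if i == j then - cb E1 else 0
  | V i, U j => if i == j then - cb E2 else 0
  | U i, U j => if j == i + 1 then cb (V (i + 2))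
                else if i == j + 1 then - cb (V (j + 2)) else 0
  | V i, V j => if j == i + 1 then cb (U (i + 2))
                else if i == j + 1 then - cb (U (j + 2)) else 0
  | _, _ => 0
  end.

Definition cayley_mul (x y : cayley) : cayley :=
  \sum_a \sum_b (x a * y b) *: cb_mul a b.

End Cayley.

Section QuotientSpace.
Variables (K : fieldType) (W : vectType K) (S : {vspace W}).
Local Notation Q := (Quotient.quot S).

Definition quot_scale (a : K) : Q -> Q := lift_op1 Q ( *:%R a).

Lemma eq_piE (x y : W) : (\pi_Q%qT x == \pi_Q%qT y) = (x - y \in S).
Proof. by rewrite -Quotient.idealrBE. Qed.

Lemma quot_scaleE a v : \pi_Q%qT (a *: v) = quot_scale a (\pi_Q%qT v).
Proof.
unlock quot_scale; apply/eqP; rewrite eq_piE -scalerBr rpredZ //.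
by rewrite -eq_piE reprK.
Qed.

Fact quot_scaleA a b x : quot_scale a (quot_scale b x) = quot_scale (a * b) x.
Proof. by rewrite -[x]reprK -!quot_scaleE scalerA. Qed.
Fact quot_scale1 : left_id 1 quot_scale.
Proof. by move=> x; rewrite -[x]reprK -quot_scaleE scale1r. Qed.
Fact quot_scaleDr : right_distributive quot_scale +%R.
Proof.
move=> a x y; rewrite -[x]reprK -[y]reprK.
by rewrite -[_ + _]raddfD /= -!quot_scaleE scalerDr [LHS]raddfD.
Qed.
Fact quot_scaleDl x : {morph quot_scale^~ x : a b / a + b}.
Proof.
by move=> a b; rewrite -[x]reprK /= -!quot_scaleE scalerDl [LHS]raddfD.
Qed.

HB.instance Definition _ := GRing.Zmodule_isLmodule.Build K Q
  quot_scaleA quot_scale1 quot_scaleDr quot_scaleDl.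

End QuotientSpace.

Section Plane.
Variable R : realType.

Definition Sline : {vspace 'rV[R]_3} := <[const_mx 1]>%VS.

Definition plane := Quotient.quot Sline.
HB.instance Definition _ := GRing.Lmodule.on plane.

Definition plane_pi (x : 'rV[R]_3) : plane := \pi_(Quotient.quot Sline)%qT x.

Definition eps (i : 'I_3) : plane := plane_pi (delta_mx 0 i).

Definition in_lattice : {pred plane} :=
  fun x => `[< exists n : 'I_3 -> int, x = \sum_i eps i *~ n i >].

Fact in_lattice_zmod_closed : zmod_closed in_lattice.
Proof.
split=> [|x y /asboolP[n ->] /asboolP[m ->]]; apply/asboolP.
  by exists (fun=> 0); rewrite big1 // => i _; rewrite mulr0z.
exists (fun i => n i - m i); rewrite -sumrB.
by apply: eq_bigr => i _; rewrite mulrzBr.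
Qed.
HB.instance Definition _ := GRing.isZmodClosed.Build plane in_lattice
  in_lattice_zmod_closed.

Record lattice := Lattice { lattice_val :> plane; _ : lattice_val \in in_lattice }.
HB.instance Definition _ := [isSub for lattice_val].
HB.instance Definition _ := [Choice of lattice by <:].
HB.instance Definition _ := [SubChoice_isSubZmodule of lattice by <:].

Fact eps_in_lattice i : eps i \in in_lattice.
Proof.
apply/asboolP; exists (fun j => (j == i)%:Z).
rewrite (bigD1 i) //= eqxx big1 ?addr0 // => j /negPf->.
by rewrite mulr0z.
Qed.
Definition leps (i : 'I_3) : lattice := Lattice (eps_in_lattice i).

Definition GL (E : lmodType R) : set (E -> E) :=
  [set f | linear f /\ bijective f].

(* The linear extension of [u : G -> G] sends the class of [(x_1, x_2, x_3)] to
   [x_1 u(eps_1) + x_2 u(eps_2) + x_3 u(eps_3)]; for additive [u] this does not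
   depend on the representative, since [eps_1 + eps_2 + eps_3 = 0]; see
   [linear_extE], [linear_ext_GL] and [linear_ext_unique]. *)
Definition linear_ext (u : lattice -> lattice) (x : plane) : plane :=
  \sum_i repr x 0 i *: (u (leps i) : plane).

End Plane.

Definition cartan_deg (R : realType) (a : cayley_basis) : lattice R :=
  match a with
  | E1 | E2 => 0
  | U i => leps R i
  | V i => - leps R i
  end.

Definition cartan (F : fieldType) (R : realType) (g : lattice R) :
    {vspace cayley F} :=
  (\sum_(a | cartan_deg R a == g) <[cb F a]>)%VS.

Definition cartan_supp (F : fieldType) (R : realType) : set (plane R) :=
  [set (s : plane R) | s in supp (@cartan F R)].
Arguments cartan_supp : clear implicits.

Definition cartan_roots (F : fieldType) (R : realType) : set (plane R) :=
  (cartan_supp F R `|`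
   [set x | exists a b, [/\ cartan_supp F R a, cartan_supp F R b,
                            a <> b, a <> - b & x = a + b]]) `\ 0.
Arguments cartan_roots : clear implicits.

Definition root_aut (R : realType) (E : lmodType R) (Phi : set E) :
    set (E -> E) :=
  [set mu | GL mu /\ mu @` Phi = Phi].

Section PlaneTheory.
Variable R : realType.

Fact plane_pi_is_linear : linear (@plane_pi R).
Proof.
move=> a x y; rewrite /plane_pi [LHS](raddfD (\pi_(Quotient.quot (Sline R))%qT)).
by congr (_ + _); exact: quot_scaleE.
Qed.
HB.instance Definition _ := GRing.isLinear.Build R 'rV[R]_3 (plane R) _
  (@plane_pi R) plane_pi_is_linear.

Lemma plane_pi_repr (x : plane R) : plane_pi (repr x) = x.
Proof. exact: reprK. Qed.

Lemma plane_pi_eq (x y : 'rV[R]_3) :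
  plane_pi x = plane_pi y <-> exists c : R, forall i, x 0 i - y 0 i = c.
Proof.
have -> : plane_pi x = plane_pi y <-> x - y \in Sline R.
  by rewrite -eq_piE; split=> [/eqP|/eqP].
split=> [/vlineP[c e]|[c e]]; last apply/vlineP; exists c.
  by move=> i; move/matrixP/(_ 0 i): e; rewrite !mxE mulr1.
by apply/rowP => i; rewrite !mxE mulr1 -(e i).
Qed.

Lemma plane_pi_sum (x : 'rV[R]_3) : plane_pi x = \sum_i x 0 i *: eps R i.
Proof.
by rewrite {1}[x]row_sum_delta linear_sum; apply: eq_bigr => i _; rewrite linearZ.
Qed.

Lemma sum_eps : \sum_i eps R i = 0.
Proof.
transitivity (plane_pi (const_mx 1 : 'rV[R]_3)).
  by rewrite plane_pi_sum; apply: eq_bigr => i _; rewrite mxE scale1r.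
rewrite -[RHS](linear0 (@plane_pi R)).
by apply/plane_pi_eq; exists 1 => i; rewrite !mxE subr0.
Qed.

Lemma sum_leps : \sum_i leps R i = 0.
Proof. by apply: val_inj; rewrite raddf_sum /= sum_eps. Qed.

Lemma lattice_valMz (x : lattice R) n : lattice_val (x *~ n) = lattice_val x *~ n.
Proof. exact: (raddfMz \val). Qed.

Lemma lattice_gen (g : lattice R) : exists n : 'I_3 -> int, g = \sum_i leps R i *~ n i.
Proof.
have /asboolP[n e] := valP g; exists n; apply: val_inj; rewrite raddf_sum [LHS]e.
by apply: eq_bigr => i _; rewrite raddfMz.
Qed.

Lemma lattice_hom_ext (H : zmodType) (f g : lattice R -> H) :
  zmod_morphism f -> zmod_morphism g -> (forall i, f (leps R i) = g (leps R i)) ->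
  f = g.
Proof.
move=> fadd gadd e; apply/funext => x.
pose fA : {additive lattice R -> H} := HB.pack f (GRing.isZmodMorphism.Build _ _ f fadd).
pose gA : {additive lattice R -> H} := HB.pack g (GRing.isZmodMorphism.Build _ _ g gadd).
have [n ->] := lattice_gen x; change (fA (\sum_i leps R i *~ n i) = gA (\sum_i leps R i *~ n i)).
rewrite !raddf_sum; apply: eq_bigr => i _; rewrite !raddfMz.
by congr (_ *~ _); exact: e.
Qed.

Lemma eps_relations (n : 'I_3 -> int) :
  \sum_i leps R i *~ n i = 0 -> forall i j, n i = n j.
Proof.
move/(congr1 val); rewrite raddf_sum /= => e.
have : @plane_pi R (\row_i (n i)%:~R) = plane_pi 0.
  rewrite linear0 plane_pi_sum -[RHS]e; apply: eq_bigr => i _.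
  by rewrite !mxE lattice_valMz scaler_int.
move=> /plane_pi_eq[c h] i j; have := h i; rewrite -(h j) !mxE !subr0.
exact: intr_inj.
Qed.

Lemma lattice_hom_exists (H : zmodType) (d : 'I_3 -> H) : \sum_i d i = 0 ->
  exists2 f : lattice R -> H, zmod_morphism f & forall i, f (leps R i) = d i.
Proof.
move=> d0; have ex g := lattice_gen g.
pose f g := \sum_i d i *~ projT1 (cid (ex g)) i.
have fE n : f (\sum_i leps R i *~ n i) = \sum_i d i *~ n i.
  rewrite /f; case: cid => m /= e.
  have h : forall i j, n i - m i = n j - m j.
    apply: (@eps_relations (fun i => n i - m i)).
    rewrite (eq_bigr _ (fun i _ => mulrzBr _ _ _)) sumrB e subrr //.
  apply/eqP; rewrite eq_sym -subr_eq0 -sumrB.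
  rewrite (eq_bigr (fun i => d i *~ (n 0 - m 0))); last first.
    by move=> i _; rewrite -mulrzBr (h i 0).
  by rewrite -mulrz_suml d0 mul0rz.
exists f => [x y|i].
  have [n ->] := lattice_gen x; have [m ->] := lattice_gen y.
  rewrite -sumrB (eq_bigr (fun i => leps R i *~ (n i - m i))) => [|i _]; last first.
    by rewrite mulrzBr.
  by rewrite !fE -sumrB; apply: eq_bigr => i _; rewrite mulrzBr.
have -> : leps R i = \sum_j leps R j *~ (j == i)%:Z.
  rewrite (bigD1 i) //= eqxx big1 ?addr0 // => j /negPf->.
  by rewrite mulr0z.
rewrite fE (bigD1 i) //= eqxx big1 ?addr0 // => j /negPf->.
by rewrite mulr0z.
Qed.
End PlaneTheory.

Section LinearExt.
Variable R : realType.
Implicit Types (u : lattice R -> lattice R).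

Lemma linear_ext_pi u x : zmod_morphism u ->
  linear_ext u (plane_pi x) = \sum_i x 0 i *: (u (leps R i) : plane R).
Proof.
move=> uadd; have := plane_pi_repr (plane_pi x).
rewrite /linear_ext; set y := repr _; move=> /plane_pi_eq[c yx].
apply/eqP; rewrite -subr_eq0 -sumrB.
rewrite (eq_bigr (fun i => c *: (u (leps R i) : plane R))) => [|i _]; last first.
  by rewrite -scalerBl yx.
pose uA : {additive lattice R -> lattice R} :=
  HB.pack u (GRing.isZmodMorphism.Build _ _ u uadd).
have us : \sum_i u (leps R i) = 0.
  by rewrite -[LHS](raddf_sum uA) sum_leps; exact: (raddf0 uA).
have vs : \sum_i (u (leps R i) : plane R) = 0.
  by rewrite -[LHS](raddf_sum \val) us.
by rewrite -scaler_sumr vs scaler0.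
Qed.

Lemma linear_ext_linear u : zmod_morphism u -> linear (linear_ext u).
Proof.
move=> uadd a x y; rewrite -(plane_pi_repr x) -(plane_pi_repr y).
rewrite -[X in linear_ext u X]linearP !linear_ext_pi // scaler_sumr -big_split.
by apply: eq_bigr => i _; rewrite !mxE scalerDl scalerA.
Qed.

Lemma plane_linear_ext (mu nu : plane R -> plane R) : linear mu -> linear nu ->
  (forall g : lattice R, mu g = nu g) -> mu = nu.
Proof.
move=> mulin nulin e; apply/funext => x.
pose muL : {linear plane R -> plane R} := HB.pack mu (GRing.isLinear.Build _ _ _ _ mu mulin).
pose nuL : {linear plane R -> plane R} := HB.pack nu (GRing.isLinear.Build _ _ _ _ nu nulin).
rewrite -(plane_pi_repr x) plane_pi_sum.
rewrite -[mu]/(muL : _ -> _) -[nu]/(nuL : _ -> _) !linear_sum.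
by apply: eq_bigr => i _; rewrite !linearZ; congr (_ *: _); exact: (e (leps R i)).
Qed.

Lemma linear_extE u (g : lattice R) : zmod_morphism u ->
  linear_ext u g = u g :> plane R.
Proof.
move=> uadd.
pose uA : {additive lattice R -> lattice R} :=
  HB.pack u (GRing.isZmodMorphism.Build _ _ u uadd).
pose L : {linear plane R -> plane R} :=
  HB.pack (linear_ext u) (GRing.isLinear.Build _ _ _ _ (linear_ext u) (linear_ext_linear uadd)).
have Lv : zmod_morphism (fun g : lattice R => L (g : plane R)).
  by move=> x y; rewrite -raddfB; congr (L _); exact: (raddfB \val).
have uv : zmod_morphism (fun g : lattice R => (u g : plane R)).
  by move=> x y; rewrite uadd; exact: (raddfB \val).
apply: (congr1 (@^~ g) (lattice_hom_ext Lv uv _)) => i.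
rewrite [LHS]linear_ext_pi // (bigD1 i) //= mxE !eqxx scale1r big1 ?addr0 // => j ji.
by rewrite mxE (negPf ji) andbF scale0r.
Qed.

Lemma linear_ext_GL u : group_aut u -> GL (linear_ext u).
Proof.
move=> [uadd [v uK vK]]; split; first exact: linear_ext_linear.
have vadd : zmod_morphism v by move=> x y; apply: (can_inj uK); rewrite uadd !vK.
have comp (p q : lattice R -> lattice R) : zmod_morphism p -> zmod_morphism q ->
    cancel p q -> cancel (linear_ext p) (linear_ext q).
  move=> padd qadd pK x; apply: (congr1 (@^~ x)
    (@plane_linear_ext (linear_ext q \o linear_ext p) id _ _ _)) => //=.
    by move=> a y z /=; rewrite !linear_ext_linear.
  by move=> g; rewrite !linear_extE // pK.
by exists (linear_ext v); apply: comp.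
Qed.

Lemma linear_ext_unique u (mu : plane R -> plane R) : zmod_morphism u -> linear mu ->
  (forall g : lattice R, mu g = u g :> plane R) -> mu = linear_ext u.
Proof.
move=> uadd mulin e; apply: plane_linear_ext => //; first exact: linear_ext_linear.
by move=> g; rewrite e linear_extE.
Qed.

End LinearExt.

Lemma sum_I3 (M : zmodType) (f : 'I_3 -> M) i :
  \sum_j f j = f i + f (i + 1) + f (i + 2).
Proof.
rewrite (reindex_inj (addrI i)) !big_ord_recl big_ord0 !addr0.
have e1 : lift ord0 ord0 = 1 :> 'I_3 by apply: val_inj.
have e2 : lift ord0 (lift ord0 ord0) = 2 :> 'I_3 by apply: val_inj.
by rewrite e1 e2 -[RHS]addr0 -[RHS]addrA -[RHS]addrA.
Qed.

Section CayleyTheory.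
Variables (F : fieldType) (R : realType).
Local Notation mul := (@cayley_mul F).
Local Notation Gam := (@cartan F R).
Local Notation deg := (@cartan_deg R).

Lemma cb_neq0 a : cb F a != 0.
Proof.
apply/eqP => /ffunP/(_ a); rewrite !ffunE eqxx => /eqP.
by rewrite oner_eq0.
Qed.

Lemma cayley_sum (x : cayley F) : x = \sum_a x a *: cb F a.
Proof.
apply/ffunP => b; rewrite sum_ffunE (bigD1 b) //= big1 => [|a ab].
  by rewrite addr0 !ffunE eqxx [RHS]mulr1.
by rewrite !ffunE (negPf ab) [LHS]mulr0.
Qed.

Lemma cayley_mul_linearl y : linear (mul^~ y).
Proof.
move=> c x x'; rewrite /cayley_mul scaler_sumr -big_split; apply: eq_bigr => a _ /=.
rewrite scaler_sumr -big_split; apply: eq_bigr => b _ /=.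
by rewrite !ffunE mulrDl scalerDl scalerA mulrA.
Qed.

Lemma cayley_mul_linearr x : linear (mul x).
Proof.
move=> c y y'; rewrite /cayley_mul scaler_sumr -big_split; apply: eq_bigr => a _ /=.
rewrite scaler_sumr -big_split; apply: eq_bigr => b _ /=.
by rewrite !ffunE mulrDr scalerDl scalerA [c * _]mulrC -mulrA [y b * c]mulrC mulrA.
Qed.

Lemma cayley_mul_cb a b : mul (cb F a) (cb F b) = cb_mul F a b.
Proof.
rewrite /cayley_mul (bigD1 a) //= [X in _ + X]big1 ?addr0 => [|c ca]; last first.
  by rewrite big1 // => d _; rewrite !ffunE eq_sym (negPf ca) mul0r scale0r.
rewrite (bigD1 b) //= big1 ?addr0 => [|c cb]; last first.
  by rewrite !ffunE [b == c]eq_sym (negPf cb) mulr0 scale0r.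
by rewrite !ffunE !eqxx mulr1 scale1r.
Qed.

Lemma cb_in a : cb F a \in Gam (deg a).
Proof.
rewrite /cartan (bigD1 a) //=; apply: (subvP (addvSl _ _)).
exact: memv_line.
Qed.

Lemma cartan_suppE : supp Gam = range deg.
Proof.
apply/seteqP; split=> g /=.
  move=> g0; apply: contrapT => ng; apply: g0; rewrite /cartan big1 // => a /eqP ag.
  by case: ng; exists a.
move=> [a _ <-] /= g0; have := cb_in a.
by rewrite g0 memv0 (negPf (cb_neq0 a)).
Qed.

Lemma leps3 (i : 'I_3) : leps R i + leps R (i + 1) + leps R (i + 2) = 0.
Proof. by rewrite -sum_I3 sum_leps. Qed.

Lemma lepsD (i : 'I_3) : leps R i + leps R (i + 1) = - leps R (i + 2).
Proof. by apply/eqP; rewrite -addr_eq0 leps3. Qed.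

Lemma cb_mul_in a b : cb_mul F a b \in Gam (deg a + deg b).
Proof.
have UU (k : 'I_3) : cb F (V (k + 2)) \in Gam (leps R k + leps R (k + 1)).
  by rewrite lepsD; exact: (cb_in (V (k + 2))).
have VV (k : 'I_3) : cb F (U (k + 2)) \in Gam (- leps R k - leps R (k + 1)).
  by rewrite -opprD lepsD opprK; exact: (cb_in (U (k + 2))).
case: a => [||i|i].
- case: b => [||j|j]; rewrite [deg E1]/= add0r.
  + exact: (cb_in E1).
  + exact: mem0v.
  + exact: (cb_in (U j)).
  + exact: mem0v.
- case: b => [||j|j]; rewrite [deg E2]/= add0r.
  + exact: mem0v.
  + exact: (cb_in E2).
  + exact: mem0v.
  + exact: (cb_in (V j)).
- case: b => [||j|j].
  + exact: mem0v.
  + by rewrite [deg E2]/= addr0; exact: (cb_in (U i)).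
  + rewrite /cb_mul; case: eqP => [->|_]; first exact: UU.
    case: eqP => [->|_]; last exact: mem0v.
    by rewrite memvN [deg _ + _]addrC; exact: UU.
  + rewrite /cb_mul; case: eqP => [->|_]; last exact: mem0v.
    by rewrite memvN [deg (V j)]/= subrr; exact: (cb_in E1).
- case: b => [||j|j].
  + by rewrite [deg E1]/= addr0; exact: (cb_in (V i)).
  + exact: mem0v.
  + rewrite /cb_mul; case: eqP => [->|_]; last exact: mem0v.
    by rewrite memvN [deg _ + _]addrC [deg (V j)]/= subrr; exact: (cb_in E2).
  + rewrite /cb_mul; case: eqP => [->|_]; first exact: VV.
    case: eqP => [->|_]; last exact: mem0v.
    by rewrite memvN [deg _ + _]addrC; exact: VV.
Qed.

Lemma cartan_coord g x a : x \in Gam g -> deg a <> g -> x a = 0.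
Proof.
move=> /memv_sumP[y yg ->] ag; rewrite sum_ffunE big1 // => b bg.
have /vlineP[k ->] := yg b bg; rewrite !ffunE.
case: eqP => [ba|_]; last exact: mulr0.
by case: ag; rewrite -ba; exact/eqP.
Qed.

Lemma cartan_grading : is_grading mul Gam.
Proof.
pose s := undup [seq deg a | a <- enum {: cayley_basis}].
have ds a : deg a \in s by rewrite mem_undup map_f // mem_enum.
have ful : (\sum_(g <- s) Gam g)%VS = fullv.
  apply/eqP; rewrite eqEsubv subvf /=; apply/subvP => x _.
  rewrite [x]cayley_sum; apply: memv_suml => a _; apply: memvZ.
  rewrite (bigD1_seq (deg a)) ?undup_uniq //=.
  by apply: (subvP (addvSl _ _)); exact: cb_in.
split.
  exists s; split=> //; first exact: undup_uniq.
    by move=> g; rewrite cartan_suppE => -[a _ <-] /=; exact: ds.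
  rewrite directvE /= eqn_leq dimv_leq_sum /= ful dimvf.
  apply: (@leq_trans #|{: cayley_basis}|); last first.
    have -> // : dim (cayley F) = #|{: cayley_basis}|.
    by rewrite /dim /= muln1.
  have le g : (\dim (Gam g) <= \sum_(a | deg a == g) 1)%N.
    apply: leq_trans (dimv_leq_sum _ _ _) _.
    by apply: leq_sum => a _; rewrite dim_vline leq_b1.
  apply: leq_trans (leq_sum _ (fun g _ => le g)) _.
  rewrite (exchange_big_dep xpredT) //= -sum1_card.
  apply: leq_sum => a _.
  rewrite big_mkcond (bigD1_seq (deg a)) ?undup_uniq //= eqxx big1 // => g.
  by rewrite eq_sym => /negPf->.
move=> g h x y xg yh; apply: memv_suml => a _; apply: memv_suml => b _.
case: (pselect (deg a = g)) => [<-|ag]; last first.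
  by rewrite (cartan_coord xg ag) mul0r scale0r mem0v.
case: (pselect (deg b = h)) => [<-|bh]; last first.
  by rewrite (cartan_coord yh bh) mulr0 scale0r mem0v.
by apply: memvZ; apply: cb_mul_in.
Qed.

Lemma cartan_universal : is_universal mul Gam.
Proof.
move=> H Del gDel e; have [_ hDel] := gDel.
have lab a : exists k, Del k = Gam (deg a).
  have [k _ <-] : [set Del k | k in supp Del] (Gam (deg a)).
    by rewrite -e; exists (deg a) => //; rewrite cartan_suppE; exists a.
  by exists k.
pose d a := projT1 (cid (lab a)).
have dE a : Del (d a) = Gam (deg a) by rewrite /d; case: cid.
have cbd a : cb F a \in Del (d a) by rewrite dE cb_in.
have dD a b c : cb_mul F a b = cb F c \/ cb_mul F a b = - cb F c -> d c = d a + d b.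
  move=> abc; apply: (grading_deg_inj gDel (cb_neq0 c)) => //.
  have := hDel _ _ _ _ (cbd a) (cbd b); rewrite cayley_mul_cb.
  by case: abc => ->; rewrite ?memvN.
have d1 : d E1 = 0.
  by apply: (addrI (d E1)); rewrite addr0 -(@dD E1 E1 E1) //; left.
have d2 : d E2 = 0.
  by apply: (addrI (d E2)); rewrite addr0 -(@dD E2 E2 E2) //; left.
have dV i : d (V i) = - d (U i).
  apply/eqP; rewrite -addr_eq0 addrC -(@dD (U i) (V i) E1) ?d1 //.
  by right; rewrite /= eqxx.
have dU : \sum_i d (U i) = 0.
  rewrite (sum_I3 _ 0) -(@dD _ _ (V (0 + 2))) ?dV ?addNr //.
  by left; rewrite /cb_mul eqxx.
have [f fadd fU] := lattice_hom_exists R dU.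
pose fA : {additive lattice R -> H} :=
  HB.pack f (GRing.isZmodMorphism.Build _ _ f fadd).
have fd a : f (deg a) = d a.
  case: a => [||i|i] /=; rewrite ?d1 ?d2 ?dV -?fU //.
  - exact: (raddf0 fA).
  - exact: (raddf0 fA).
  - exact: (raddfN fA).
exists f; split.
  split=> // s; rewrite cartan_suppE => -[a _ <-].
  by rewrite fd dE.
move=> f' [f'add f'E]; apply: lattice_hom_ext => // i; rewrite fU.
apply: (grading_deg_inj gDel (cb_neq0 (U i))) => //.
have iS : supp Gam (leps R i) by rewrite cartan_suppE; exists (U i).
by rewrite (f'E _ iS); exact: (cb_in (U i)).
Qed.

End CayleyTheory.

(* Main.v *)
Require Import Defs.
From HB Require Import structures.
From mathcomp Require Import all_boot all_order all_algebra.
From mathcomp Require Import boolp classical_sets reals.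

Set Implicit Arguments.
Unset Strict Implicit.
Unset Printing Implicit Defensive.

Import GRing.Theory Num.Theory.
Local Open Scope ring_scope.
Local Open Scope classical_set_scope.

(** The group of all [linear_ext u] and [Aut Phi] coincide with the group of
    order 12 of the maps [eps i |-> s * eps (t i)], for a sign [s] and a
    permutation [t] of the three indices.

    An element of the Weyl group permutes the support, as it comes from an
    automorphism that permutes the components ([weyl_supp]).  Since [Phi] is
    built from the support by the linear structure alone, its linear extension
    preserves [Phi] ([cartan_roots_stable]).

    Conversely, let [mu] be in [Aut Phi].  The short roots [+- eps i] are the
    roots whose triple is a sum of two roots: on the one hand
    [3 eps i = (eps i - eps (i+1)) + (eps i - eps (i+2))]; on the other, the
    functional [x |-> x_i - x_j] is at most 2 on [Phi], but 6 on the triple of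
    the long root [eps i - eps j].  This characterization is linear, so [mu]
    permutes the short roots ([root_aut_short]).  In [mu (eps i) = +- eps (t i)]
    the map [t] is a permutation because [mu] is injective, and the three signs
    agree because every integer relation among the [eps i] is a multiple of
    [eps 0 + eps 1 + eps 2 = 0] ([root_aut_affine]).

    It remains to lift these maps to the algebra.  A permutation of the
    integers modulo 3 is affine, [i |-> k + i] or [i |-> k - i].  In the first
    case it preserves the multiplication table when applied to the indices of the
    [u_i] and [v_i].  In the second case it reverses the cyclic order, hence
    changes the sign of the products [u_i u_(i+1)] and [v_i v_(i+1)]; replacing
    the [u_i] and [v_i] by their opposites at the same time repairs this.  The
    sign [s = -1] is obtained by exchanging [e_1] with [e_2] and [u_i] with
    [v_i].  All these automorphisms are monomial in the good basis
    ([lift_cb_mul], [weyl_relabel]). *)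

(** * Monomial automorphisms of the Cayley algebra *)

Section Monomial.
Variables (F : fieldType) (R : realType).
Variables (f g : cayley_basis -> cayley_basis) (c : cayley_basis -> F).
Hypotheses (fK : cancel f g) (gK : cancel g f) (c0 : forall a, c a != 0).

Definition monomial_fun (x : cayley F) : cayley F := [ffun d => c (g d) * x (g d)].

Fact monomial_fun_linear : linear monomial_fun.
Proof. by move=> k x y; apply/ffunP => d; rewrite !ffunE mulrDr mulrCA. Qed.
HB.instance Definition _ :=
  GRing.isLinear.Build F (cayley F) (cayley F) _ monomial_fun monomial_fun_linear.

Definition monomial : 'End(cayley F) := linfun monomial_fun.

Lemma monomial_cb a : monomial (cb F a) = c a *: cb F (f a).
Proof.
rewrite lfunE; apply/ffunP => d; rewrite !ffunE (can2_eq fK gK).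
by case: eqP => [->|]; rewrite ?mulr0 ?scaler0.
Qed.

Lemma monomial_bij : bijective monomial.
Proof.
exists (fun y : cayley F => [ffun a => (c a)^-1 * y (f a)] : cayley F) => x;
  apply/ffunP => a.
  by rewrite ffunE lfunE ffunE fK mulKf.
by rewrite lfunE !ffunE gK mulVKf.
Qed.

Hypothesis cb_mor : forall a b,
  (c a * c b) *: cb_mul F (f a) (f b) = monomial (cb_mul F a b).

(** Both sides are bilinear, so it suffices to compare them on the good basis. *)
Lemma monomial_aut : algebra_aut (@cayley_mul F) monomial.
Proof.
split=> [|x y]; first exact: monomial_bij.
pose mulL z := HB.pack_for {linear cayley F -> cayley F} (@cayley_mul F ^~ z)
  (GRing.isLinear.Build _ _ _ _ (@cayley_mul F ^~ z) (cayley_mul_linearl z)).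
pose mulR z := HB.pack_for {linear cayley F -> cayley F} (@cayley_mul F z)
  (GRing.isLinear.Build _ _ _ _ (@cayley_mul F z) (cayley_mul_linearr z)).
have mulZl (z w : cayley F) k : cayley_mul (k *: w) z = k *: cayley_mul w z.
  exact: (linearZ_LR (mulL z) k w).
have mulZr (z w : cayley F) k : cayley_mul z (k *: w) = k *: cayley_mul z w.
  exact: (linearZ_LR (mulR z) k w).
rewrite [LHS]linear_sum {2}[x]cayley_sum linear_sum.
rewrite [RHS](linear_sum (mulL (monomial y))); apply: eq_bigr => a _ /=.
rewrite [LHS]linear_sum {2}[y]cayley_sum linear_sum.
rewrite [RHS](linear_sum (mulR _)); apply: eq_bigr => b _ /=.
rewrite linearZ /= -cb_mor !linearZ /= !monomial_cb.
rewrite !(mulZl, mulZr) cayley_mul_cb !scalerA; congr (_ *: _).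
by rewrite mulrACA -[RHS]mulrA [x a * _]mulrC [y b * _]mulrC.
Qed.

Hypothesis deg_f : forall a b,
  (cartan_deg R (f a) == cartan_deg R (f b)) = (cartan_deg R a == cartan_deg R b).

(** If [f] permutes the fibres of the degree, it carries the basis of one
    component onto the basis of another. *)
Lemma monomial_cartan a :
  (monomial @: cartan F (cartan_deg R a))%VS = cartan F (cartan_deg R (f a)).
Proof.
rewrite /cartan limg_sum [RHS](reindex f) /=; last by exists g => ? _.
apply: eq_big => b; first by rewrite deg_f.
move=> _; rewrite limg_line monomial_cb; apply/eqP.
rewrite eqEsubv -!memvE memvZ ?memv_line //=.
by rewrite -[X in X \in _](scalerK (c0 b)) memvZ ?memv_line.
Qed.

Lemma monomial_grading_aut : grading_aut (@cayley_mul F) (@cartan F R) monomial.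
Proof.
split; first exact: monomial_aut.
apply/seteqP; rewrite cartan_suppE; split=> W [_ [a _ <-] <-].
  by exists (cartan_deg R (f a)); [exists (f a)|rewrite monomial_cartan].
by exists (cartan_deg R (g a)); [exists (g a)|rewrite monomial_cartan gK].
Qed.

End Monomial.

(** * Permutations of the integers modulo 3 *)

(** The sign [(-1) ^+ b] is taken in the integers modulo 3, so that [b] says
    whether the cyclic order of the indices is reversed. *)
Definition affine (b : bool) (k i : 'I_3) : 'I_3 := k + (-1) ^+ b * i.

Lemma affineK b k : cancel (affine b k) (affine b (- ((-1) ^+ b * k))).
Proof. by move=> i; rewrite /affine mulrDr mulrA -signr_addb addbb mul1r addKr. Qed.

Lemma affineVK b k : cancel (affine b (- ((-1) ^+ b * k))) (affine b k).
Proof.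
by move=> i; rewrite /affine mulrDr mulrN !mulrA -signr_addb addbb !mul1r addNKr.
Qed.

Lemma injective_affine (t : 'I_3 -> 'I_3) : injective t ->
  exists b, forall i, t i = affine b (t 0) i.
Proof.
move=> tI; exists (t 1 != t 0 + 1).
have n01 : t 0 != t 1 by rewrite (inj_eq tI).
have n02 : t 0 != t 2 by rewrite (inj_eq tI).
have n12 : t 1 != t 2 by rewrite (inj_eq tI).
suff e : t 1 = affine (t 1 != t 0 + 1) (t 0) 1 /\
         t 2 = affine (t 1 != t 0 + 1) (t 0) 2.
  move=> i; have [->|->|->] : [\/ i = 0, i = 1 | i = 2].
  - by case: i => [[|[|[|//]]] ?]; [apply: Or31|apply: Or32|apply: Or33]; apply: val_inj.
  - by rewrite /affine mulr0 addr0.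
  - exact: e.1.
  - exact: e.2.
by move: n01 n02 n12; case: (t 0) (t 1) (t 2)
  => [[|[|[|//]]] ?] [[|[|[|//]]] ?] [[|[|[|//]]] ?] //= _ _ _;
  split; apply: val_inj.
Qed.

(** * Lifting the signed permutations of the indices *)

Definition flip (s : bool) (a : cayley_basis) : cayley_basis :=
  if s then match a with E1 => E2 | E2 => E1 | U i => V i | V i => U i end
  else a.

Definition relabel (s b : bool) (k : 'I_3) (a : cayley_basis) : cayley_basis :=
  flip s (match a with
          | U i => U (affine b k i) | V i => V (affine b k i) | _ => a
          end).

Lemma relabelK s b k : cancel (relabel s b k) (relabel s b (- ((-1) ^+ b * k))).
Proof. by case: s => -[||i|i] //=; rewrite /relabel /= affineK. Qed.

Lemma relabelVK s b k : cancel (relabel s b (- ((-1) ^+ b * k))) (relabel s b k).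
Proof. by case: s => -[||i|i] //=; rewrite /relabel /= affineVK. Qed.

Section Lift.
Variables (F : fieldType) (R : realType).

(** These signs compensate for the reversal of the cyclic order: with
    [u_i |-> c u_(k-i)] and [v_i |-> d v_(k-i)], the product [u_i v_i = - e_1]
    forces [c d = 1] and [u_i u_(i+1) = v_(i+2)] forces [d = - c^2], whose only
    solution with [c] a sign is [c = d = -1]. *)
Definition relabel_coef (b : bool) (a : cayley_basis) : F :=
  match a with E1 | E2 => 1 | _ => (-1) ^+ b end.

Lemma relabel_coef_neq0 b a : relabel_coef b a != 0.
Proof. by case: a => [||i|i]; rewrite ?oner_eq0 ?signr_eq0. Qed.

(** The common shape of the two tables [u_i u_j] and [v_i v_j], with [W] the
    family to which the products belong. *)
Definition cyclic_product (W : 'I_3 -> cayley F) (i j : 'I_3) : cayley F :=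
  if j == i + 1 then W (i + 2) else if i == j + 1 then - W (j + 2) else 0.

Lemma cyclic_product_affine W b k i j :
  cyclic_product W (affine b k i) (affine b k j) =
  (-1) ^+ b *: cyclic_product (fun l => W (affine b k l)) i j.
Proof.
rewrite /cyclic_product /affine; case: b; rewrite /= ?expr1 ?expr0 ?scaleN1r ?scale1r.
  have e (l m : 'I_3) : (k + -1 * l == k + -1 * m + 1) = (m == l + 1).
    by rewrite -addrA (inj_eq (addrI k)) !mulN1r -(inj_eq oppr_inj) opprK opprD
      opprK eq_sym subr_eq.
  have v (l : 'I_3) : k + -1 * (l + 1) + 2 = k + -1 * (l + 2).
    by rewrite !mulN1r !opprD -!addrA; do 2!congr (_ + _); apply: val_inj.
  rewrite !e; have [->|_] := eqVneq j (i + 1).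
    have -> : (i == i + 1 + 1) = false.
      by rewrite -addrA -[X in X == _]addr0 (inj_eq (addrI i)).
    by rewrite v.
  by case: eqVneq => [->|_]; rewrite ?v ?opprK ?oppr0.
have e (l m : 'I_3) : (k + 1 * l == k + 1 * m + 1) = (l == m + 1).
  by rewrite -addrA (inj_eq (addrI k)) !mul1r.
by rewrite !e !mul1r !addrA.
Qed.

Definition lift (s b : bool) (k : 'I_3) : 'End(cayley F) :=
  monomial (relabel s b (- ((-1) ^+ b * k))) (relabel_coef b).

Lemma lift_cb s b k a :
  lift s b k (cb F a) = relabel_coef b a *: cb F (relabel s b k a).
Proof. by apply: monomial_cb; [exact: relabelK | exact: relabelVK]. Qed.

Lemma linear_cyclic_product (h : 'End(cayley F)) W i j :
  h (cyclic_product W i j) = cyclic_product (fun l => h (W l)) i j.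
Proof. by rewrite /cyclic_product; do 2?case: ifP => _; rewrite ?linearN ?linear0. Qed.

(** The [u_i] and [v_i] all carry the sign [(-1) ^+ b], so in a product of two of
    them the signs on the left cancel.  For [u_i u_j] and [v_i v_j] one sign is
    left on the right, and [cyclic_product_affine] provides it on the left; for
    [u_i v_j] and [v_i u_j] the product lies in the span of [e_1] and [e_2],
    where no sign occurs. *)
Lemma lift_cb_mul s b k a a' :
  (relabel_coef b a * relabel_coef b a') *:
    cb_mul F (relabel s b k a) (relabel s b k a') = lift s b k (cb_mul F a a').
Proof.
have cycE (W : 'I_3 -> cayley F) i j (X : 'I_3 -> cayley_basis) :
    (forall l, relabel_coef b (X l) = (-1) ^+ b) ->
    (forall l, W (affine b k l) = cb F (relabel s b k (X l))) ->
    ((-1) ^+ b * (-1) ^+ b) *: cyclic_product W (affine b k i) (affine b k j) =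
    lift s b k (cyclic_product (fun l => cb F (X l)) i j).
  move=> cX WX; rewrite -signr_addb addbb scale1r cyclic_product_affine.
  rewrite linear_cyclic_product /cyclic_product !lift_cb !cX !WX.
  by do 2?case: ifP => _; rewrite ?scalerN ?scaler0.
have orthE i j c c' : relabel_coef b c' = 1 -> c = relabel s b k c' ->
    ((-1) ^+ b * (-1) ^+ b) *:
      (if affine b k i == affine b k j then - cb F c else 0) =
    lift s b k (if i == j then - cb F c' else 0).
  move=> c1 ->; rewrite -signr_addb addbb scale1r (can_eq (affineK b k)).
  by case: eqP; rewrite ?linear0 // linearN /= lift_cb c1 scale1r.
case: s cycE orthE => cycE orthE; case: a => [||i|i]; case: a' => [||j|j];
  rewrite /= ?linear0 ?lift_cb /= ?mul1r ?mulr1 ?scaler0 //.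
- exact: (cycE (fun l => cb F (U l)) _ _ V).
- exact: orthE.
- exact: orthE.
- exact: (cycE (fun l => cb F (V l)) _ _ U).
- exact: (cycE (fun l => cb F (V l)) _ _ V).
- exact: orthE.
- exact: orthE.
- exact: (cycE (fun l => cb F (U l)) _ _ U).
Qed.

Local Notation deg := (cartan_deg R).

Lemma relabel_hom s b k : exists2 w : lattice R -> lattice R, zmod_morphism w &
  forall a, w (deg a) = deg (relabel s b k a).
Proof.
have [|w wadd wU] := @lattice_hom_exists R _ (fun i => deg (relabel s b k (U i))).
  have e0 : \sum_i leps R (affine b k i) = 0.
    by rewrite -[RHS](sum_leps R) [RHS](reindex_inj (can_inj (affineK b k))).
  by case: s; rewrite /= ?sumrN e0 ?oppr0.
pose wA : {additive lattice R -> lattice R} :=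
  HB.pack w (GRing.isZmodMorphism.Build _ _ w wadd).
have w0 : w 0 = 0 by exact: (raddf0 wA).
have wN x : w (- x) = - w x by exact: (raddfN wA).
exists w => // -[||i|i] /=; rewrite ?w0 ?wN ?wU; case: (s) => //=.
by rewrite opprK.
Qed.

(** The map on degrees is an automorphism of the lattice because the inverse
    relabelling has the same form. *)
Lemma weyl_relabel s b k : exists2 u, weyl_group (@cayley_mul F) (@cartan F R) u &
  forall a, u (deg a) = deg (relabel s b k a).
Proof.
have [u uadd uE] := relabel_hom s b k.
have [v vadd vE] := relabel_hom s b (- ((-1) ^+ b * k)).
have inv p q : zmod_morphism p -> zmod_morphism q ->
    (forall i, q (p (leps R i)) = leps R i) -> cancel p q.
  move=> padd qadd pq x; apply: (congr1 (@^~ x) (_ : q \o p = id)).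
  by apply: lattice_hom_ext => // y z /=; rewrite padd qadd.
have uK : cancel u v by apply: inv => // i; rewrite (uE (U i)) vE relabelK.
have vK : cancel v u by apply: inv => // i; rewrite (vE (U i)) uE relabelVK.
have deg_eq a a' :
    (deg (relabel s b k a) == deg (relabel s b k a')) = (deg a == deg a').
  by rewrite -!uE (can_eq uK).
have aut : grading_aut (@cayley_mul F) (@cartan F R) (lift s b k).
  apply: monomial_grading_aut (relabelK s b k) (relabelVK s b k) _ _ deg_eq.
    exact: relabel_coef_neq0.
  exact: lift_cb_mul.
exists u => //; split; first by split=> //; exists v.
exists (lift s b k) => // g; rewrite cartan_suppE => -[a _ <-]; rewrite uE.
apply: monomial_cartan (relabelK s b k) (relabelVK s b k) _ deg_eq _.
exact: relabel_coef_neq0.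
Qed.

End Lift.

(** * Short and long roots *)

Section Roots.
Variables (F : fieldType) (R : realType).
Local Notation deg := (cartan_deg R).
Local Notation Supp := (cartan_supp F R).
Local Notation Phi := (cartan_roots F R).

Lemma cartan_suppP x :
  Supp x <-> [\/ x = 0, exists i, x = eps R i | exists i, x = - eps R i].
Proof.
rewrite /cartan_supp cartan_suppE; split=> [[_ [a _ <-] <-]|].
  by case: a => [||i|i]; [apply: Or31|apply: Or31|apply: Or32|apply: Or33]; try exists i.
case=> [->|[i ->]|[i ->]]; [exists (deg E1)|exists (deg (U i))|exists (deg (V i))] => //.
Qed.

Lemma eps_supp i : Supp (eps R i).
Proof. by apply/cartan_suppP/Or32; exists i. Qed.

Lemma epsN_supp i : Supp (- eps R i).
Proof. by apply/cartan_suppP/Or33; exists i. Qed.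

(** A coordinate of a class modulo the line of [(1, 1, 1)] depends on the
    representative, but a difference of two coordinates does not
    ([coord_diff_pi]). *)
Definition coord_diff (i j : 'I_3) (x : plane R) : R := repr x 0 i - repr x 0 j.

Lemma coord_diff_pi i j (y : 'rV[R]_3) : coord_diff i j (plane_pi y) = y 0 i - y 0 j.
Proof.
have /plane_pi_eq[c h] := plane_pi_repr (plane_pi y).
have e k : repr (plane_pi y) 0 k = c + y 0 k by rewrite -(h k) subrK.
by rewrite /coord_diff !e opprD addrACA subrr add0r.
Qed.

Lemma coord_diff_zmod i j : zmod_morphism (coord_diff i j).
Proof.
move=> x y; rewrite -(plane_pi_repr x) -(plane_pi_repr y) -linearB !coord_diff_pi !mxE.
by rewrite !opprD !opprK addrACA.
Qed.
HB.instance Definition _ i j :=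
  GRing.isZmodMorphism.Build _ _ (coord_diff i j) (coord_diff_zmod i j).

Lemma coord_diff_eps i j k : coord_diff i j (eps R k) = (i == k)%:R - (j == k)%:R.
Proof. by rewrite coord_diff_pi !mxE. Qed.

Lemma coord_diff_supp i j x : Supp x -> coord_diff i j x <= 1.
Proof.
have bd (p q : bool) : p%:R - q%:R <= 1 :> R.
  by rewrite lerBlDr -(natrD _ 1) ler_nat; case: p q => -[].
move=> /cartan_suppP[->|[k ->]|[k ->]].
- by rewrite raddf0.
- by rewrite coord_diff_eps.
- by rewrite raddfN /= coord_diff_eps opprB.
Qed.

Lemma coord_diff_root i j x : Phi x -> coord_diff i j x <= 1 + 1.
Proof.
move=> [[sx|[a [c [sa sc _ _ ->]]]] _].
  by rewrite -[coord_diff _ _ _]addr0 lerD ?ler01 ?coord_diff_supp.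
by rewrite raddfD lerD ?coord_diff_supp.
Qed.

Lemma eps_sub_neq0 i j : i != j -> eps R i - eps R j != 0.
Proof.
move=> ij; apply/eqP => /(congr1 (coord_diff i j)); rewrite raddfB raddf0 /=.
rewrite !coord_diff_eps !eqxx [j == i]eq_sym (negPf ij) subr0 sub0r opprK.
by apply/eqP; rewrite (pnatr_eq0 _ 2).
Qed.

Lemma eps_add_neq0 i j : eps R i + eps R j != 0.
Proof.
(* Modulo [(1, 1, 1)] a third coordinate is needed to tell the sum from 0. *)
have [l li lj] : exists2 l, l != i & l != j.
  by case: i j => [[|[|[|//]]] ?] [[|[|[|//]]] ?];
    first [by exists 0 | by exists 1 | by exists 2].
apply/eqP => /(congr1 (coord_diff i l)); rewrite raddfD raddf0 /=.
rewrite !coord_diff_eps eqxx (negPf li) (negPf lj) !subr0 -natrD.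
by apply/eqP; rewrite pnatr_eq0.
Qed.

Lemma eps_neq0 i : eps R i != 0.
Proof.
by apply: contraNneq (eps_add_neq0 i i) => ->; rewrite addr0.
Qed.

Lemma eps_add i j : i != j -> exists l, eps R i + eps R j = - eps R l.
Proof.
have next k : eps R k + eps R (k + 1) = - eps R (k + 2).
  exact: (congr1 val (lepsD R k)).
move=> ij; have [->|->] : j = i + 1 \/ i = j + 1.
- by move: ij; case: i j => [[|[|[|//]]] ?] [[|[|[|//]]] ?] // _;
    by [left; apply: val_inj|right; apply: val_inj].
- by exists (i + 2).
- by exists (j + 2); rewrite addrC.
Qed.

Lemma long_root x : Phi x -> ~ Supp x -> exists i j, i != j /\ x = eps R i - eps R j.
Proof.
move=> [[//|[y [z [sy sz yz yNz ->]]]] _] nS.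
have y0 : y <> 0 by move=> y0; apply: nS; rewrite y0 add0r.
have z0 : z <> 0 by move=> z0; apply: nS; rewrite z0 addr0.
move: (sy) (sz) => /cartan_suppP[//|[i ye]|[i ye]] /cartan_suppP[//|[j ze]|[j ze]].
all: have ij : i != j by apply/eqP => ij; by [ apply: yz; rewrite ye ze ij
                                     | apply: yNz; rewrite ye ze ij ?opprK ].
all: rewrite ye ze in nS *.
- by case: nS; have [l ->] := eps_add ij; exact: epsN_supp.
- by exists i, j.
- by exists j, i; rewrite eq_sym addrC.
- by case: nS; rewrite -opprD; have [l ->] := eps_add ij; rewrite opprK; exact: eps_supp.
Qed.

(** The difference of the coordinates [i] and [j] is 6 on the right and at most
    2 + 2 on the left. *)
Lemma long_root_not_third i j y z : i != j -> Phi y -> Phi z ->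
  y + z <> (eps R i - eps R j) *+ 3.
Proof.
move=> ij py pz /(congr1 (coord_diff i j)); rewrite raddfD raddfMn raddfB /=.
rewrite !coord_diff_eps !eqxx [j == i]eq_sym (negPf ij) subr0 sub0r opprK => e.
have := lerD (coord_diff_root i j py) (coord_diff_root i j pz).
by rewrite e -!natrD -mulrnA ler_nat.
Qed.

Lemma eps_sub_root i j : i != j -> Phi (eps R i - eps R j).
Proof.
move=> ij; split; last by move=> /eqP; rewrite (negPf (eps_sub_neq0 ij)).
right; exists (eps R i), (- eps R j); split=> //.
- exact: eps_supp.
- exact: epsN_supp.
- by move/eqP; rewrite -addr_eq0 (negPf (eps_add_neq0 i j)).
- by move/eqP; rewrite opprK -subr_eq0 (negPf (eps_sub_neq0 ij)).
Qed.

Lemma eps_root i : Phi (eps R i).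
Proof.
split; last by move=> /eqP; rewrite (negPf (eps_neq0 i)).
by left; exact: eps_supp.
Qed.

Lemma eps_third i : exists y z, [/\ Phi y, Phi z & y + z = eps R i *+ 3].
Proof.
exists (eps R i - eps R (i + 1)), (eps R i - eps R (i + 2)); split.
- by apply: eps_sub_root; rewrite -subr_eq0 opprD addrA subrr.
- by apply: eps_sub_root; rewrite -subr_eq0 opprD addrA subrr.
have := sum_eps R; rewrite (sum_I3 _ i) => /eqP; rewrite -addrA addrC addr_eq0 => /eqP e.
by rewrite addrACA -opprD e opprK !mulrS addr0 addrA.
Qed.

(** The triple of [eps R i] is a sum of two roots, a property that linear maps
    preserving the roots transport and that no long root has. *)
Lemma root_aut_short mu i : root_aut Phi mu ->
  exists (s : bool) k, mu (eps R i) = (-1) ^+ s *: eps R k.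
Proof.
move=> [[mulin [nu muK _]] muPhi].
pose muL : {linear plane R -> plane R} :=
  HB.pack mu (GRing.isLinear.Build _ _ _ _ mu mulin).
have muR x : Phi x -> Phi (mu x) by rewrite -[X in _ -> X (_)]muPhi => px; exists x.
have [y [z [py pz yz]]] := eps_third i.
have e3 : mu y + mu z = mu (eps R i) *+ 3.
  by rewrite -[LHS](raddfD muL) yz; exact: (raddfMn muL).
have pe := muR _ (eps_root i).
have [|nS] := pselect (Supp (mu (eps R i))); last first.
  have [j [l [jl e]]] := long_root pe nS.
  by case: (long_root_not_third jl (muR _ py) (muR _ pz)); rewrite e3 e.
have n0 : mu (eps R i) <> 0 by case: pe.
move=> /cartan_suppP[//|[k e]|[k e]].
  by exists false, k; rewrite expr0 scale1r.
by exists true, k; rewrite expr1 scaleN1r.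
Qed.

(** The relation [eps 0 + eps 1 + eps 2 = 0], transported by [mu], is a relation
    among the [eps] whose coefficients are the signs; in such a relation all
    coefficients are equal. *)
Lemma root_aut_affine mu : root_aut Phi mu ->
  exists (s b : bool) k, forall i, mu (eps R i) = (-1) ^+ s *: eps R (affine b k i).
Proof.
move=> rmu; have [[mulin [nu muK _]] _] := rmu.
pose muL : {linear plane R -> plane R} :=
  HB.pack mu (GRing.isLinear.Build _ _ _ _ mu mulin).
have /choice[sk skE] : forall i, exists p : bool * 'I_3,
    mu (eps R i) = (-1) ^+ p.1 *: eps R p.2.
  by move=> i; have [s [k e]] := root_aut_short i rmu; exists (s, k).
have tI : injective (fun i => (sk i).2).
  move=> i j; apply: contra_eq => ij; apply/eqP => /= tij.
  have : mu (eps R i) = mu (eps R j) \/ mu (eps R i) = mu (- eps R j).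
    rewrite [mu (- _)](raddfN muL) /= !skE tij.
    case: (sk i).1 (sk j).1 => -[]; rewrite ?expr0 ?expr1 ?scale1r ?scaleN1r ?opprK;
    by [left | right].
  case=> /(can_inj muK) /eqP; first by rewrite -subr_eq0 (negPf (eps_sub_neq0 ij)).
  by rewrite -addr_eq0 (negPf (eps_add_neq0 i j)).
have [b tE] := injective_affine tI.
set k := (sk 0).2 in tE.
have s_const i j : (sk i).1 = (sk j).1.
  pose n l : int := (-1) ^+ (sk l).1.
  (* The coefficient of [eps l] is the sign at the index sent to [l]. *)
  have e0 : \sum_l leps R l *~ n (affine b (- ((-1) ^+ b * k)) l) = 0.
    rewrite (reindex_inj (can_inj (affineK b k))); apply: val_inj.
    transitivity (muL (\sum_l eps R l)); last by rewrite sum_eps; exact: (raddf0 muL).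
    rewrite raddf_sum [RHS](raddf_sum muL).
    apply: eq_bigr => l _; rewrite affineK; transitivity (mu (eps R l)) => //.
    by rewrite skE /= tE [LHS]lattice_valMz -scaler_int rmorph_sign.
  have := eps_relations e0 (affine b k i) (affine b k j); rewrite !affineK /n.
  by case: (sk i).1 (sk j).1 => -[].
exists (sk 0).1, b, k => i.
by rewrite skE (s_const i 0) tE.
Qed.

(** * The Weyl group and the automorphisms of the root system *)

(** The roots are defined from the support by sums, opposites and zero. *)
Lemma cartan_roots_stable mu : linear mu -> injective mu ->
  mu @` Supp = Supp -> mu @` Phi = Phi.
Proof.
move=> mulin muI muS.
pose muL : {linear plane R -> plane R} :=
  HB.pack mu (GRing.isLinear.Build _ _ _ _ mu mulin).
have mu0 : mu 0 = 0 by exact: (raddf0 muL).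
have muN x : mu (- x) = - mu x by exact: (raddfN muL).
have muD x y : mu (x + y) = mu x + mu y by exact: (raddfD muL).
have muSu x : Supp x -> Supp (mu x) by rewrite -[X in _ -> X (_)]muS => sx; exists x.
have muSV x : Supp x -> exists2 y, Supp y & mu y = x by rewrite -{1}muS.
apply/seteqP; split=> [_ [x [xP x0] <-]|x [xP x0]].
  split; last by move=> /= e; apply: x0; apply: muI; rewrite mu0.
  case: xP => [|[a [c [sa sc ac aNc ->]]]]; [by left; apply: muSu|right].
  exists (mu a), (mu c); split; rewrite -?muD -?muN; try exact: muSu.
  - by move/muI.
  - by move/muI.
  - by [].
case: xP x0 => [/muSV[y sy <-]|[a [c [/muSV[a' sa <-] /muSV[c' sc <-] ac aNc ->]]]] x0.
  exists y => //; split; first by left.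
  by move=> /= y0; apply: x0; rewrite y0.
exists (a' + c'); last by rewrite muD.
split; last by move=> /= y0; apply: x0; rewrite /= -muD y0.
right; exists a', c'; split=> //.
  by move=> e; apply: ac; rewrite e.
by move=> e; apply: aNc; rewrite e muN.
Qed.

(** That [u] reaches every degree [g] of the support: the component of degree [g]
    is the image of some component of degree [h], which has degree [u h], and a
    nonzero element has only one degree. *)
Lemma weyl_supp u : weyl_group (@cayley_mul F) (@cartan F R) u ->
  linear_ext u @` Supp = Supp.
Proof.
move=> [[uadd _] [phi [ap comp] ind]].
apply/seteqP; split=> x.
  move=> [_ [g sg <-] <-]; exists (u g); last by rewrite linear_extE.
  exact: induces_supp ap ind sg.
move=> [g sg <-].
have [h sh e] : [set (phi @: @cartan F R s)%VS | s in supp (@cartan F R)] (cartan F g).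
  by rewrite comp; exists g.
exists (h : plane R); first by exists h.
rewrite linear_extE //; congr lattice_val.
move: sg; rewrite cartan_suppE => -[a _ ga].
apply: (grading_deg_inj (cartan_grading F R) (cb_neq0 F a)).
  by rewrite -(ind _ sh) e -ga cb_in.
by rewrite -ga cb_in.
Qed.

End Roots.

Theorem theorem3p3 (F : closedFieldType) (R : realType) :
  [set linear_ext u | u in weyl_group (@cayley_mul F) (@cartan F R)] =
  root_aut (cartan_roots F R).
Proof.
apply/seteqP; split=> [_ [u uW <-]|mu rmu].
  have GLu := linear_ext_GL uW.1; split=> //.
  by apply: (cartan_roots_stable GLu.1 (bij_inj GLu.2)); exact: weyl_supp.
have [s [b [k muE]]] := root_aut_affine rmu.
have [u uW uE] := weyl_relabel F R s b k.
exists u => //; have uadd := uW.1.1; have mulin := rmu.1.1.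
pose muL : {linear plane R -> plane R} :=
  HB.pack mu (GRing.isLinear.Build _ _ _ _ mu mulin).
apply/esym/linear_ext_unique => // g.
have mu_add : zmod_morphism (fun g : lattice R => mu g).
  by move=> x y; rewrite -[RHS](raddfB muL); congr mu; exact: (raddfB \val).
have u_add : zmod_morphism (fun g : lattice R => (u g : plane R)).
  by move=> x y; rewrite uadd; exact: (raddfB \val).
apply: (congr1 (@^~ g) (lattice_hom_ext mu_add u_add _)) => i.
by rewrite (uE (U i)) [LHS]muE; case: (s); rewrite ?expr1 ?expr0 ?scaleN1r ?scale1r.
Qed.
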